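(* Let $N\ge 1$. The map $\mathrm{pr}$ from permutation tableaux of half-perimeter $N+1$ to states of the PASEP with $N$ sites gives a projection from the PT chain on permutation tableaux of half-perimeter $N+1$ to the PASEP with $N$ sites; that is, the PT chain projects to the PASEP via $\mathrm{pr}$.
   Context: Parameters: $\alpha,\beta>0$ and $q\ge 0$ are real numbers such that all transition probabilities below lie in $[0,1]$ (e.g. $0<\alpha,\beta\le 1$, $0\le q\le 1$). Projection of Markov chains. Let $M$ and $N'$ be Markov chains on finite sets $X$ and $Y$, and let $F:X\to Y$ be surjective. $M$ projects to $N'$ (via $F$) if: (i) whenever $x_1,x_2\in X$ and $\mathrm{prob}_M(x_1\to x_2)>0$, then $\mathrm{prob}_M(x_1\to x_2)=\mathrm{prob}_{N'}(F(x_1)\to F(x_2))$; (ii) whenever $y_1,y_2\in Y$ and $\mathrm{prob}_{N'}(y_1\to y_2)>0$, then for each $x_1\in X$ with $F(x_1)=y_1$ there is a unique $x_2\in X$ with $F(x_2)=y_2$ and $\mathrm{prob}_M(x_1\to x_2)>0$; moreover $\mathrm{prob}_M(x_1\to x_2)=\mathrm{prob}_{N'}(y_1\to y_2)$. PASEP with $N$ sites. The Markov chain on words of length $N$ in $\{\circ,\bullet\}$ (equivalently $\{0,1\}^N$ with $\bullet=1$, $\circ=0$) with: if $X=A\bullet\circ B$ and $Y=A\circ\bullet B$ then $P_{X,Y}=\frac1{N+1}$ and $P_{Y,X}=\frac q{N+1}$; if $X=\circ B$, $Y=\bullet B$ then $P_{X,Y}=\frac\alpha{N+1}$; if $X=B\bullet$,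 $Y=B\circ$ then $P_{X,Y}=\frac\beta{N+1}$; otherwise $P_{X,Y}=0$ for $Y\ne X$, and $P_{X,X}=1-\sum_{Y\neq X}P_{X,Y}$. Permutation tableaux. A partition $\lambda=(\lambda_1\ge\dots\ge\lambda_t)$, $t\ge 1$, is a weakly decreasing sequence of nonnegative integers (parts equal to $0$ are allowed and counted as rows). Its Young diagram is left-justified with $\lambda_i$ boxes in row $i$ (rows numbered from top to bottom); its half-perimeter is the number of rows plus the number of columns, $t+\lambda_1$. The length of a row or column is its number of boxes. A permutation tableau of shape $\lambda$ is a filling of the boxes with $0$'s and $1$'s such that (1) each column contains at least one $1$; (2) there is no $0$ which has both a $1$ above it in the same column and a $1$ to its left in the same row. A $1$ is superfluous if there is another $1$ above it in its column, and necessary if it is the unique $1$ in its column. The map $\mathrm{pr}$. For $\mathcal T$ of shape $\lambda$ and half-perimeter $N+1$, let $p=(p_1,\dots,p_{N+1})\in\{S,W\}^{N+1}$ be the lattice path of unit south and west steps along the south-east border of the Young diagram from its north-east corner to its south-west corner (explicitly, for $r=1,\dots,t$ in turn: one step $S$ followed by $\lambda_r-\lambda_{r+1}$ steps $W$, with $\lambda_{t+1}:=0$); so $p_1=S$. Then $\mathrm{pr}(\mathcal T)=(\tau_1,\dots,\tau_N)$ with $\tau_i=1$ iff $p_{i+1}=S$. The PT chain is the Markov chain on the permutation tableaux of half-perimeter $N+1$ whose transitions from a tableau $\mathcal S$ of shape $\lambda=(\lambda_1,\dots,\lambda_t)$ are the following (inserting a row ''as far south as possible'' means below all rows of length at least that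 of the new row; inserting a column ''as far east as possible'' means to the right of all columns of length at least that of the new column). (a) Particle enters from the left. If the rightmost column of $\mathcal S$ exists and has length $1$: delete this column and insert a new all-zero row of length $\lambda_1-1$ as far south as possible. Probability $\alpha/(N+1)$. (b) Particle hops right. For every $j\ge 2$ with $\lambda_j>\lambda_{j+1}$ (where $\lambda_{t+1}:=0$) there is one transition, of probability $1/(N+1)$. Case 1: if the rightmost entry of row $j$ is $0$ (then row $j$ is all zeros), delete row $j$ and insert a new row of $\lambda_j-1$ zeros as far south as possible. Case 2: if the rightmost entry of row $j$ is a superfluous $1$, delete that box. Case 3: if the rightmost entry of row $j$ is a necessary $1$, delete the column containing it (which has length $j$) and insert, as far east as possible, a new column of length $j-1$ consisting of $0$'s except for a $1$ in its bottom box. (c) Particle exits to the right. If $t\ge 2$ and $\lambda_t=0$: delete row $t$ and insert, as far to the right as possible, a new column of length $t-1$ consisting (top to bottom) of $t-2$ zeros followed by a $1$. Probability $\beta/(N+1)$. (d) Particle hops left. For every $1\le j\le t-1$ with $\lambda_j>\lambda_{j+1}$: increase the length of row $j+1$ by $1$ and fill the new box with a $1$. Probability $q/(N+1)$. All other transitions between distinct states have probability $0$, and with the remaining probability the chain stays in its current state. *)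

(* Defs.v *)
From mathcomp Require Import all_boot all_order all_algebra.
From mathcomp Require Import boolp reals.

Set Implicit Arguments.
Unset Strict Implicit.
Unset Printing Implicit Defensive.

Import Order.TTheory GRing.Theory Num.Theory.

Section Chains.
Local Open Scope ring_scope.

Definition markov_chain (R : realType) (X : finType) (P : X -> X -> R) : Prop :=
  (forall x y, 0 <= P x y) /\ (forall x, \sum_y P x y = 1).

(* [step x y] is only meaningful for x != y; the remaining probability is put
   on the diagonal. *)
Definition chain_of_step (R : realType) (X : finType) (step : X -> X -> R)
    (x y : X) : R :=
  if x == y then 1 - \sum_(z | z != x) step x z else step x y.

Definition projects_to (R : realType) (X Y : finType)
    (M : X -> X -> R) (P : Y -> Y -> R) (F : X -> Y) : Prop :=
  [/\ markov_chain M,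
      markov_chain P,
      forall y, exists x, F x = y,
      forall x1 x2, 0 < M x1 x2 -> M x1 x2 = P (F x1) (F x2)
    & forall y1 y2, 0 < P y1 y2 -> forall x1, F x1 = y1 ->
        exists2 x2, unique (fun x => F x = y2 /\ 0 < M x1 x) x2
                  & M x1 x2 = P y1 y2].

End Chains.

(* Words on particles (true) and holes (false). *)

Section Pasep.
Local Open Scope ring_scope.

Definition hop (X Y : seq bool) : Prop :=
  exists A B, X = A ++ [:: true, false & B] /\ Y = A ++ [:: false, true & B].

Definition enter (X Y : seq bool) : Prop :=
  exists B, X = false :: B /\ Y = true :: B.

Definition exit (X Y : seq bool) : Prop :=
  exists B, X = rcons B true /\ Y = rcons B false.

Definition pasep_step (R : realType) (N : nat) (alpha beta q : R)
    (X Y : N.-tuple bool) : R :=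
  if `[< hop X Y >] then 1 / N.+1%:R
  else if `[< hop Y X >] then q / N.+1%:R
  else if `[< enter X Y >] then alpha / N.+1%:R
  else if `[< exit X Y >] then beta / N.+1%:R
  else 0.

Definition pasep (R : realType) (N : nat) (alpha beta q : R) :
    N.-tuple bool -> N.-tuple bool -> R :=
  chain_of_step (pasep_step alpha beta q).

End Pasep.

(* A filled diagram is the list of its rows from north to south, each row
   being the list of its entries from west to east (true = 1, false = 0).
   Rows and columns are indexed from 0; empty rows are kept. *)
Notation filling := (seq (seq bool)).

Definition row_len (T : filling) (i : nat) : nat := size (nth [::] T i).

Definition ncols (T : filling) : nat := row_len T 0.

Definition entry (T : filling) (i j : nat) : bool := nth false (nth [::] T i) j.

Definition column (T : filling) (j : nat) : seq bool :=
  [seq nth false r j | r <- T & j < size r].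

Definition col_len (T : filling) (j : nat) : nat := size (column T j).

Definition one_left (T : filling) (i j : nat) : bool :=
  has (fun j' => entry T i j') (iota 0 j).

Definition one_above (T : filling) (i j : nat) : bool :=
  has (fun i' => entry T i' j) (iota 0 i).

Definition superfluous (T : filling) (i j : nat) : bool :=
  entry T i j && one_above T i j.

Definition necessary (T : filling) (i j : nat) : bool :=
  entry T i j && (count id (column T j) == 1).

Definition is_perm_tableau (T : filling) : bool :=
  [&& 0 < size T,
      sorted geq [seq size r | r <- T],
      all (fun j => true \in column T j) (iota 0 (ncols T))
    & all (fun i =>
        all (fun j =>
          ~~ [&& ~~ entry T i j, one_above T i j & one_left T i j])
        (iota 0 (row_len T i)))
      (iota 0 (size T))].

Definition half_perimeter (T : filling) : nat := size T + ncols T.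

Definition pt_pred (N : nat) (T : filling) : bool :=
  is_perm_tableau T && (half_perimeter T == N.+1).

(* Bounded sequences make this a finType; the bounds are no restriction,
   see [perm_tableau_exists]. *)
Definition perm_tableau (N : nat) : Type :=
  {T : {bseq N.+1 of {bseq N of bool}}
     | pt_pred N [seq bseqval r | r <- T]}.

Definition rows (N : nat) (T : perm_tableau N) : filling :=
  [seq bseqval r | r <- bseqval (sval T)].

Coercion rows : perm_tableau >-> list.

Lemma rows_inj (N : nat) : injective (@rows N).
Proof.
move=> S T /inj_map eqST; apply/val_inj/val_inj; apply: eqST.
exact: (@val_inj _ _ {bseq N of bool}).
Qed.

Lemma perm_tableau_exists (N : nat) (T : filling) :
  pt_pred N T -> exists T' : perm_tableau N, rows T' = T.
Proof.
move=> ptT; have /andP[/and4P[T_gt0 T_sorted _ _] /eqP hp] := ptT.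
have leT : size T <= N.+1 by rewrite -hp leq_addr.
have ler r : r \in T -> size r <= N.
  case: T {ptT leT} T_gt0 T_sorted hp => [//|r0 T] _ /=.
  rewrite /half_perimeter /ncols /row_len /= addSn => T_sorted [hp].
  have le_r0 : size r0 <= N by rewrite -hp leq_addl.
  rewrite inE => /predU1P[-> //|rT]; apply: leq_trans le_r0.
  have geq_trans : transitive geq by move=> a b c /= ab /leq_trans; apply.
  by move: T_sorted => /(order_path_min geq_trans)/allP/(_ _ (map_f size rT)).
have size_B : size [seq insub_bseq N r | r <- T] <= N.+1 by rewrite size_map.
have eqT : [seq bseqval r | r <- Bseq size_B] = T.
  rewrite /= -map_comp -[RHS]map_id; apply/eq_in_map => r /ler rN /=.
  by rewrite /insub_bseq /insubd insubT.
have ptB : pt_pred N [seq bseqval r | r <- Bseq size_B] by rewrite eqT.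
by exists (exist _ (Bseq size_B) ptB); rewrite /rows /= -[RHS]eqT.
Qed.

(* Steps of the south-east border from its north-east corner:
   true = S, false = W. *)
Definition border (T : filling) : seq bool :=
  flatten [seq true :: nseq (row_len T r - row_len T r.+1) false
          | r <- iota 0 (size T)].

Definition pr (N : nat) (T : perm_tableau N) : N.-tuple bool :=
  [tuple nth false (border T) i.+1 | i < N].

Definition insert_row (r : seq bool) (T : filling) : filling :=
  let k := count (fun r' => size r <= size r') T in
  take k T ++ r :: drop k T.

Definition delete_row (i : nat) (T : filling) : filling :=
  take i T ++ drop i.+1 T.

Definition insert_col (c : seq bool) (T : filling) : filling :=
  let k := count (fun j => size c <= col_len T j) (iota 0 (ncols T)) in
  mkseq (fun i =>
    let r := nth [::] T i in
    if i < size c then take k r ++ nth false c i :: drop k r else r) (size T).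

Definition delete_col (j : nat) (T : filling) : filling :=
  [seq take j r ++ drop j.+1 r | r <- T].

Definition delete_last_box (i : nat) (T : filling) : filling :=
  set_nth [::] T i (take (row_len T i).-1 (nth [::] T i)).

Definition append_one (i : nat) (T : filling) : filling :=
  set_nth [::] T i (rcons (nth [::] T i) true).

(* The column of height h (from top to bottom) 0, ..., 0, 1. *)
Definition unit_col (h : nat) : seq bool := rcons (nseq h.-1 false) true.

Definition pt_enter (S T : filling) : bool :=
  let c := (ncols S).-1 in
  [&& 0 < ncols S, col_len S c == 1
    & T == insert_row (nseq c false) (delete_col c S)].

(* Since rows are indexed from 0, the column through the corner box of row j
   has length j + 1. *)
Definition pt_hop_right (j : nat) (S T : filling) : bool :=
  let c := (row_len S j).-1 in
  (row_len S j.+1 < row_len S j) &&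
  [|| ~~ entry S j c && (T == insert_row (nseq c false) (delete_row j S)),
      superfluous S j c && (T == delete_last_box j S)
    | necessary S j c && (T == insert_col (unit_col j) (delete_col c S))].

Definition pt_exit (S T : filling) : bool :=
  let t := size S in
  [&& 1 < t, row_len S t.-1 == 0
    & T == insert_col (unit_col t.-1) (delete_row t.-1 S)].

Definition pt_hop_left (j : nat) (S T : filling) : bool :=
  (row_len S j.+1 < row_len S j) && (T == append_one j.+1 S).

Section PTChain.
Local Open Scope ring_scope.

Definition pt_step (R : realType) (N : nat) (alpha beta q : R)
    (S T : perm_tableau N) : R :=
  (alpha / N.+1%:R) *+ pt_enter S T
  + \sum_(1 <= j < size S) (1 / N.+1%:R) *+ pt_hop_right j S T
  + (beta / N.+1%:R) *+ pt_exit S T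
  + \sum_(0 <= j < (size S).-1) (q / N.+1%:R) *+ pt_hop_left j S T.

Definition pt_chain (R : realType) (N : nat) (alpha beta q : R) :
    perm_tableau N -> perm_tableau N -> R :=
  chain_of_step (pt_step alpha beta q).

End PTChain.

(* Main.v *)
Require Import Defs.
From mathcomp Require Import all_boot all_order all_algebra.
From mathcomp Require Import boolp reals.
From mathcomp Require Import zify.

Set Implicit Arguments.
Unset Strict Implicit.
Unset Printing Implicit Defensive.

Import Order.TTheory GRing.Theory Num.Theory.

(** The idea.  Reading the south-east border of a tableau as a word, with a
particle for each south step, makes the shape of the tableau and the border
word equivalent data: the row lengths are recovered by counting, for each south
step, the west steps that follow it ([parts]), and this is injective on words
of a given length ([parts_inj]).  The border always starts with a south step,
so [pr] only drops a letter that carries no information, and [pr S = Y] says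
exactly that [S] has shape [parts (true :: Y)] ([prE]).

Through this dictionary each PASEP move is a move on partitions ([hopP],
[enterP], [exitP]).  A particle hopping right removes the corner box of a row
other than the first; a particle hopping left does the converse; a particle
entering takes a box off a first row longer than all others and adds a second
row as long as what is left of the first; a particle leaving turns an empty
last row into a column.

What remains is that each such partition move has exactly one refinement to
permutation tableaux, namely the tableau produced by the transition of the PT
chain: the filling it describes is again a permutation tableau, and it has the
right shape ([enter_result], [exit_result], [hop_right_result],
[hop_left_result]).  The only move with a choice is the hop to the right, and
there the entry in the corner box decides: a corner 0 sits in a zero row
([corner_zero_row]), while a corner 1 is either superfluous or necessary and
never both ([corner_column]).

Hence for a tableau [S] and a word [Y] the off-diagonal rates out of [S] into
the fibre of [pr] over [Y] are concentrated on one tableau, where the rate is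
that of the PASEP from [pr S] to [Y] ([step_lift]).  This is a strong form of
lumpability, and it yields the projection, the diagonal included: summing over
the fibres, the total exit rates of [S] and [pr S] agree
([projects_of_lift]). *)

(** * Border words and row lengths *)

(** The partition whose border is [w], [true] being a south step: a south step
ends a row as long as the number of west steps still to come. *)
Fixpoint parts (w : seq bool) : seq nat :=
  if w is b :: w' then
    if b then count negb w' :: parts w' else parts w'
  else [::].

Definition decr (j : nat) (l : seq nat) : seq nat :=
  set_nth 0 l j (nth 0 l j).-1.

Definition corner (j : nat) (l : seq nat) : bool := nth 0 l j.+1 < nth 0 l j.

Lemma size_parts w : size (parts w) = count id w.
Proof. by elim: w => [|[] w IH] //=; rewrite IH. Qed.

Lemma count_id_negb w : count id w + count negb w = size w.
Proof. exact: (count_predC id). Qed.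

Lemma parts_cat u v :
  parts (u ++ v) = map (addn (count negb v)) (parts u) ++ parts v.
Proof.
elim: u => [|[] u IH] //=; rewrite IH //.
by rewrite count_cat addnC.
Qed.

Lemma head_parts w : nth 0 (parts w) 0 <= count negb w.
Proof. by elim: w => [|[] w IH] //=; lia. Qed.

(** The number of parts determines the number of west steps when the length is
known.  If one word starts with a south step and the other with a west step,
the first part of the former is too large for the latter. *)
Lemma parts_inj w w' : size w = size w' -> parts w = parts w' -> w = w'.
Proof.
have aux (u v : seq bool) : size u = size v ->
    count negb u :: parts u <> parts v.
  move=> suv e.
  have := head_parts v; rewrite -e /=.
  have := congr1 size e; rewrite /= !size_parts.
  have := count_id_negb u; have := count_id_negb v; lia.
elim: w w' => [|b w IH] [|b' w'] //= [sw].
case: b b' => [] [] /=.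
- by move=> [_ /(IH _ sw) ->].
- by move/aux => /(_ sw).
- by move/esym/aux => /(_ (esym sw)).
- by move=> /(IH _ sw) ->.
Qed.

Lemma decr_cat l1 x l2 : decr (size l1) (l1 ++ x :: l2) = l1 ++ x.-1 :: l2.
Proof. by rewrite /decr; elim: l1 => //= y l1 ->. Qed.

Lemma split_at_particle w j : j < count id w ->
  exists A B, w = A ++ true :: B /\ count id A = j.
Proof.
elim: w j => [|[] w IH] [|j] //=; rewrite ?add0n ?add1n ?ltnS.
- by exists [::], w.
- by case/IH => A [B [-> <-]]; exists (true :: A), B.
- by case/IH => A [B [-> <-]]; exists (false :: A), B.
- by case/IH => A [B [-> <-]]; exists (false :: A), B.
Qed.

Lemma corner_cat l1 x l2 : corner (size l1) (l1 ++ x :: l2) = (nth 0 l2 0 < x).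
Proof. by rewrite /corner; elim: l1. Qed.

(** Exchanging two adjacent letters of a word affects only the parts produced
by these letters and leaves those produced before and after them alone. *)
Lemma parts_split A B : exists2 l, size l = count id A
  & forall C, count negb C = count negb B -> parts (A ++ C) = l ++ parts C.
Proof.
exists (map (addn (count negb B)) (parts A)); first by rewrite size_map size_parts.
by move=> C <-; rewrite parts_cat.
Qed.

Lemma corner_hop A B :
  corner (count id A) (parts (A ++ [:: true, false & B])).
Proof.
have [l <- ->//] := parts_split A [:: true, false & B].
by rewrite /= corner_cat ltnS head_parts.
Qed.

Lemma parts_hop A B : parts (A ++ [:: false, true & B])
  = decr (count id A) (parts (A ++ [:: true, false & B])).
Proof.
have [l <- E] := parts_split A [:: true, false & B].
by rewrite !E //= decr_cat.
Qed.

(** A hop to the right trades a corner SW of the border for WS, which removes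
the corner box.  The initial south step, which produces the first part, is not a
particle; hence the bound [0 < j]. *)
Lemma hopP (X Y : seq bool) : size X = size Y ->
  hop X Y <->
  exists2 j, 0 < j < size (parts (true :: X))
     & corner j (parts (true :: X)) /\ parts (true :: Y) = decr j (parts (true :: X)).
Proof.
move=> sXY; split.
  move=> [A [B [-> ->]]]; exists (count id A).+1.
    by rewrite size_parts /= count_cat /=; lia.
  split; first exact: (corner_hop (true :: A)).
  exact: (parts_hop (true :: A)).
case=> j /andP[j_gt0 j_lt] [cj Yj].
rewrite size_parts in j_lt.
have [A [B [e Aj]]] := split_at_particle j_lt.
case: A e Aj => [|a A] /=; first by move=> _ jE; move: j_gt0; rewrite -jE.
case=> ? e Aj; subst a; have [l sl E] := parts_split (true :: A) (true :: B).
have eX : true :: X = (true :: A) ++ true :: B by rewrite e.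
have {cj}: nth 0 (parts B) 0 < count negb B.
  by move: cj; rewrite eX E // -Aj -[_ + _]sl corner_cat.
case: B e {E eX} => [|[] B] e /=; rewrite ?ltnn // => _.
exists A, B; split => //.
suff [] : true :: Y = true :: A ++ [:: false, true & B] by [].
apply: parts_inj; first by rewrite /= -sXY e !size_cat.
by rewrite Yj e -Aj; apply: esym; exact: (parts_hop (true :: A)).
Qed.

(** The first letter of [X] is a hole exactly when the first part exceeds all
others; turning the hole into a particle replaces the part [n.+1] by two parts
[n]. *)
Lemma enterP (X Y : seq bool) : size X = size Y ->
  enter X Y <-> exists n l, [/\ parts (true :: X) = n.+1 :: l, nth 0 l 0 <= n
                   & parts (true :: Y) = [:: n, n & l]].
Proof.
move=> sXY; split.
  move=> [B [-> ->]]; exists (count negb B), (parts B).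
  by split=> //; apply: head_parts.
case=> n [l []]; case: X sXY => [|[] X] //= sXY [Xn Xl].
  by move: Xn; rewrite -Xl /=; lia.
move=> _ [Yn Yl]; exists X; split => //.
apply: parts_inj; rewrite //= Yl.
congr (_ :: _) => //; lia.
Qed.

Lemma parts_rcons_particle w : parts (rcons w true) = rcons (parts w) 0.
Proof. by rewrite -cats1 parts_cat /= map_id cats1. Qed.

Lemma parts_rcons_hole w : parts (rcons w false) = map S (parts w).
Proof. by rewrite -cats1 parts_cat /= cats0. Qed.

(** A final south step is an empty last row; a final west step is a column that
meets every row. *)
Lemma exitP (X Y : seq bool) : size X = size Y ->
  exit X Y <-> exists2 l, 0 < size l & parts (true :: X) = rcons l 0 /\
                           parts (true :: Y) = map S l.
Proof.
move=> sXY; split.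
  move=> [B [-> ->]]; exists (parts (true :: B)) => //.
  by rewrite -!rcons_cons parts_rcons_particle parts_rcons_hole.
case=> l l_gt0; case: (lastP X) sXY => [|B b] sXY [Xl Yl].
  by case: l Xl Yl l_gt0 => [|? []].
exists B; case: b sXY Xl => sXY; rewrite -rcons_cons.
  rewrite parts_rcons_particle => /rcons_inj[Xl]; split=> //.
  suff [] : true :: Y = true :: rcons B false by [].
  apply: parts_inj; first by rewrite /= -sXY !size_rcons.
  by rewrite Yl -rcons_cons parts_rcons_hole -Xl.
rewrite parts_rcons_hole => /(congr1 (last 1)).
by rewrite last_rcons (last_map S _ 0).
Qed.

(** * Permutation tableaux and their shapes *)

Lemma row_lenE T i : row_len T i = nth 0 (shape T) i.
Proof.
rewrite /row_len /shape; case: (ltnP i (size T)) => iT.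
  by rewrite (nth_map [::]).
by rewrite !nth_default ?size_map.
Qed.

Lemma shape_eq T l : size T = size l -> (forall i, row_len T i = nth 0 l i) -> shape T = l.
Proof.
move=> sT Tl; apply: (@eq_from_nth _ 0); rewrite size_map // => i _.
by rewrite -row_lenE.
Qed.

Lemma row_len_mono T i i' :
  sorted geq (shape T) -> i <= i' -> row_len T i' <= row_len T i.
Proof.
move=> sT; case: (ltnP i' (size T)) => iT ii'; last by rewrite /row_len nth_default.
rewrite !row_lenE; apply: (sorted_leq_nth _ _ 0 sT) => //.
- by move=> a b c /= ba /leq_trans; apply.
- exact: leqnn.
- by rewrite inE size_map; lia.
- by rewrite inE size_map; lia.
Qed.

Lemma entry_lt T i j : entry T i j -> j < row_len T i.
Proof.
by apply: contraTT; rewrite -leqNgt /entry => ?; rewrite nth_default.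
Qed.

Lemma one_leftP T i j : reflect (exists2 j', j' < j & entry T i j') (one_left T i j).
Proof.
by apply: (iffP hasP) => -[j' a b]; exists j' => //; move: a; rewrite mem_iota.
Qed.

Lemma one_aboveP T i j : reflect (exists2 i', i' < i & entry T i' j) (one_above T i j).
Proof.
by apply: (iffP hasP) => -[j' a b]; exists j' => //; move: a; rewrite mem_iota.
Qed.

Lemma column_true T j : true \in column T j <-> exists i, entry T i j.
Proof.
split.
  case/mapP => r; rewrite mem_filter => /andP[_ rT] e.
  by exists (index r T); rewrite /entry nth_index.
case=> i e; apply/mapP; exists (nth [::] T i); last by [].
rewrite mem_filter (entry_lt e) mem_nth //.
by move: e; rewrite /entry; case: ltnP => // iT; rewrite (nth_default [::]) // nth_nil.
Qed.

(** The two conditions on the entries, kept apart from the condition on the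
shape because the steps of a transition treat them separately. *)
Definition pt_rule (T : filling) : Prop :=
  (forall j, j < ncols T -> exists i, entry T i j) /\
  (forall i j, j < row_len T i -> one_above T i j -> one_left T i j -> entry T i j).

Lemma is_perm_tableauP T :
  is_perm_tableau T <-> [/\ 0 < size T, sorted geq (shape T) & pt_rule T].
Proof.
split.
  case/and4P => T0 sT /allP cT /allP rT; split=> //; split.
    by move=> j jT; apply/column_true/cT; rewrite mem_iota.
  move=> i j ji ab le.
  have iT : i \in iota 0 (size T).
    rewrite mem_iota; case: ltnP => // iT.
    by move: ji; rewrite /row_len nth_default.
  have /allP/(_ j) := rT _ iT; rewrite mem_iota => /(_ ji).
  by rewrite ab le !andbT negbK.
case=> T0 sT [cT rT]; apply/and4P; split=> //; apply/allP => i.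
  by rewrite mem_iota => /cT /column_true.
move=> iT; apply/allP => j; rewrite mem_iota => ji.
apply/negP => /and3P[/negP n a l]; exact/n/rT.
Qed.

Lemma border_cons r T :
  border (r :: T) = true :: nseq (size r - ncols T) false ++ border T.
Proof.
rewrite /border /= /row_len /=; congr (_ :: _ ++ flatten _).
by rewrite -(addn0 1) iotaDl -map_comp.
Qed.

Lemma border_spec T : sorted geq (shape T) ->
  parts (border T) = shape T /\ count negb (border T) = ncols T.
Proof.
elim: T => [//|r T IH] pT.
have [IHp IHn] := IH (path_sorted pT).
have rT : ncols T <= size r.
  by case: T pT {IH IHp IHn} => [|r' T] //= /andP[].
have cB : count negb (nseq (size r - ncols T) false ++ border T) = size r.
  by rewrite count_cat count_nseq /= mul1n IHn subnK.
rewrite border_cons /= cB; split; last by [].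
by congr (_ :: _); rewrite parts_cat IHp; elim: (_ - _).
Qed.

Lemma size_border T : sorted geq (shape T) -> size (border T) = half_perimeter T.
Proof.
move=> sT; rewrite -count_id_negb -size_parts; have [-> ->] := border_spec sT.
by rewrite size_map.
Qed.

Section Tab.
Variable N : nat.
Implicit Types S T : perm_tableau N.

Lemma tabP S : [/\ 0 < size S, sorted geq (shape S), pt_rule S & half_perimeter S = N.+1].
Proof. by have /andP[/is_perm_tableauP[] ? ? ? /eqP] := svalP S; split. Qed.

(** The border of [S] is [true :: pr S], so the word [pr S] encodes the shape. *)
Lemma shape_pr S : shape S = parts (true :: pr S).
Proof.
have [S0 sS _ hS] := tabP S.
have [<- _] := border_spec sS; congr parts.
have := size_border sS; rewrite hS.
have : head false (border S) = true by case: (rows S) S0 => // r T; rewrite border_cons.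
case E : (border S) => [//|b w]; rewrite [head _ _]/= => -> [sw]; congr (_ :: _).
apply: (@eq_from_nth _ false); first by rewrite size_tuple.
by move=> i; rewrite sw => iN; rewrite (nth_mktuple _ _ (Ordinal iN)) E.
Qed.

Lemma prE S (Y : N.-tuple bool) : pr S = Y <-> shape S = parts (true :: Y).
Proof.
split=> [<-|]; first exact: shape_pr.
rewrite shape_pr => e; apply: val_inj.
suff [] : true :: val (pr S) = true :: val Y by [].
by apply: parts_inj; rewrite // [LHS](size_tuple [tuple of _ :: pr S]) (size_tuple [tuple of _ :: Y]).
Qed.

(** The half-perimeter is the length of the border, so a filling with the shape
of a word of the right length has the right half-perimeter too. *)
Lemma tableau_of_shape (Y : N.-tuple bool) (T : filling) :
  sorted geq (shape T) -> pt_rule T -> shape T = parts (true :: Y) ->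
  exists2 T' : perm_tableau N, rows T' = T & pr T' = Y.
Proof.
move=> sT fT e.
have [] // := @perm_tableau_exists N T; last first.
  by move=> T' TT'; exists T' => //; apply/prE; rewrite TT'.
apply/andP; split; first by apply/is_perm_tableauP; split=> //; rewrite -(size_map size) -/(shape T) e.
rewrite /half_perimeter /ncols row_lenE -(size_map size) -/(shape T) e size_parts /=.
by rewrite add1n addSn count_id_negb size_tuple.
Qed.

End Tab.

(** * Deleting and inserting rows, columns and boxes *)

Lemma nth_delete (T : Type) (x : T) s c j :
  nth x (take c s ++ drop c.+1 s) j = nth x s (bump c j).
Proof.
rewrite nth_cat size_take /bump; case: (ltnP c (size s)) => cs.
  case: (ltnP j c) => jc; first by rewrite nth_take.
  by rewrite nth_drop; congr nth; lia.
case: (ltnP j (size s)) => js; first by rewrite take_oversize // leqNgt (leq_trans js cs).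
by rewrite drop_oversize ?nth_nil ?nth_default //; lia.
Qed.

Lemma nth_insert (T : Type) (x y : T) s k j : k <= size s ->
  nth x (take k s ++ y :: drop k s) (bump k j) = nth x s j.
Proof.
move=> ks; rewrite nth_cat size_takel // /bump; case: (leqP k j) => kj.
  by rewrite ltnNge leqW // subSn //= nth_drop subnKC.
by rewrite kj nth_take.
Qed.

Lemma nth_insert_eq (T : Type) (x y : T) s k : k <= size s ->
  nth x (take k s ++ y :: drop k s) k = y.
Proof. by move=> ks; rewrite nth_cat size_takel // ltnn subnn. Qed.

(** After an insertion at position [k], an index is either the new one or the
new name [bump k i] of an old index [i]. *)
Variant bump_spec k : nat -> Prop :=
  | BumpEq : bump_spec k k
  | BumpOff i : bump_spec k (bump k i).

Lemma bumpP k i : bump_spec k i.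
Proof.
case: (eqVneq i k) => [->|ik]; first exact: BumpEq.
by rewrite -(@unbumpK k i) ?inE //; apply: BumpOff.
Qed.

Lemma ltn_bump k i j : (bump k i < bump k j) = (i < j).
Proof. by rewrite !ltnNge leq_bump2. Qed.

Lemma bump0 k : 0 < k -> bump k 0 = 0.
Proof. by rewrite /bump; case: k. Qed.

Lemma entry_delete_col c T i j : entry (delete_col c T) i j = entry T i (bump c j).
Proof.
rewrite /entry /delete_col; case: (ltnP i (size T)) => iT.
  by rewrite (nth_map [::]) // nth_delete.
by rewrite !(nth_default [::]) ?size_map // !nth_nil.
Qed.

Lemma row_len_delete_col c T i :
  row_len (delete_col c T) i = row_len T i - (c < row_len T i).
Proof.
rewrite /row_len /delete_col; case: (ltnP i (size T)) => iT.
  by rewrite (nth_map [::]) // size_cat size_drop size_take; case: ltnP => h /=; lia.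
by rewrite !nth_default ?size_map.
Qed.

Lemma size_delete_col c T : size (delete_col c T) = size T.
Proof. by rewrite size_map. Qed.

Lemma sorted_shape T :
  (forall i, row_len T i.+1 <= row_len T i) -> sorted geq (shape T).
Proof. by move=> h; apply/(sortedP 0) => i _ /=; rewrite -!row_lenE. Qed.

Lemma sorted_delete_col c T :
  sorted geq (shape T) -> sorted geq (shape (delete_col c T)).
Proof.
move=> sT; apply: sorted_shape => i; rewrite !row_len_delete_col.
have := row_len_mono sT (leqnSn i); lia.
Qed.

(** Deleting a column of a tableau removes potential left witnesses of the
second condition and creates none. *)
Lemma pt_rule_delete_col c T : pt_rule T -> pt_rule (delete_col c T).
Proof.
move=> [cT rT]; have bl i j : j < row_len (delete_col c T) i -> bump c j < row_len T i.
  by rewrite row_len_delete_col /bump; lia.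
split=> [j /bl /cT [i e]|i j /bl ji]; first by exists i; rewrite entry_delete_col.
case/one_aboveP => i' i'i; rewrite entry_delete_col => e1.
case/one_leftP => j' j'j; rewrite !entry_delete_col => e2.
apply: rT => //; first by apply/one_aboveP; exists i'.
by apply/one_leftP; exists (bump c j'); rewrite ?ltn_bump.
Qed.

Lemma entry_delete_row k T i j : entry (delete_row k T) i j = entry T (bump k i) j.
Proof. by rewrite /entry nth_delete. Qed.

Lemma row_len_delete_row k T i : row_len (delete_row k T) i = row_len T (bump k i).
Proof. by rewrite /row_len nth_delete. Qed.

Lemma sorted_delete_row k T :
  sorted geq (shape T) -> sorted geq (shape (delete_row k T)).
Proof.
move=> sT; apply: sorted_shape => i; rewrite !row_len_delete_row.
by apply: row_len_mono => //; rewrite leq_bump2.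
Qed.

(** A zero row contributes neither ones to the columns nor witnesses to the
second condition.  The first row has to stay since it carries the columns. *)
Lemma pt_rule_delete_row k T : 0 < k -> (forall j, ~~ entry T k j) ->
  pt_rule T -> pt_rule (delete_row k T).
Proof.
move=> k_gt0 k0 [cT rT]; split=> [j|i j].
  rewrite /ncols row_len_delete_row bump0 // => /cT[i].
  case: (bumpP k i) => [e|{}i e]; first by rewrite (negPf (k0 j)) in e.
  by exists i; rewrite entry_delete_row.
rewrite row_len_delete_row entry_delete_row => ji.
case/one_aboveP => i' i'i; rewrite entry_delete_row => e1.
case/one_leftP => j' j'j; rewrite entry_delete_row => e2.
apply: rT => //; last by apply/one_leftP; exists j'.
by apply/one_aboveP; exists (bump k i'); rewrite ?ltn_bump.
Qed.

(** A zero row has no 1 to the left of any of its boxes.  As it is not longer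
than the first row, it is inserted below it and the columns are unchanged. *)
Lemma pt_rule_insert_zero_row n T : n <= ncols T -> 0 < size T ->
  pt_rule T -> pt_rule (insert_row (nseq n false) T).
Proof.
rewrite /insert_row size_nseq => nT T_gt0 [cT rT].
set k := count _ T; have kT : k <= size T by apply: count_size.
have k_gt0 : 0 < k.
  by move: T_gt0 nT; rewrite /k /ncols /row_len; case: (T) => //= r T' _ ->.
set U := _ ++ _.
have ek j : entry U k j = false by rewrite /entry nth_insert_eq // nth_nseq if_same.
have eb i j : entry U (bump k i) j = entry T i j by rewrite /entry nth_insert.
have rb i : row_len U (bump k i) = row_len T i by rewrite /row_len nth_insert.
split=> [j|i j].
  rewrite /ncols -(bump0 k_gt0) rb => /cT[i e].
  by exists (bump k i); rewrite eb.
case: (bumpP k i) => [_ _ /one_leftP[j' _]|{}i]; first by rewrite !ek.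
rewrite rb eb => ji /one_aboveP[i' i'i e1] /one_leftP[j' j'j]; rewrite eb => e2.
apply: rT => //; last by apply/one_leftP; exists j'.
apply/one_aboveP; move: i'i e1; case: (bumpP k i') => [|{}i']; rewrite ?ek // eb.
by rewrite ltn_bump; exists i'.
Qed.

Lemma shape_insert_row r T :
  shape (insert_row r T) =
  let k := count (fun n => size r <= n) (shape T) in
  take k (shape T) ++ size r :: drop k (shape T).
Proof. by rewrite /= count_map /insert_row /shape map_cat map_take /= map_drop. Qed.

Lemma sorted_insert (n : nat) s : sorted geq s ->
  let k := count (fun m => n <= m) s in sorted geq (take k s ++ n :: drop k s).
Proof.
have gt : transitive geq by move=> a b c /= ba /leq_trans; apply.
elim: s => [//|m s IH] /= ms; have := order_path_min gt ms.
have {IH} := IH (path_sorted ms).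
case: (leqP n m) => nm /=.
  move=> h am; rewrite path_min_sorted //.
  by rewrite all_cat /= nm -all_cat cat_take_drop.
move=> _ am; have -> : count (fun m => n <= m) s = 0.
  apply/eqP; rewrite -leqn0 leqNgt -has_count -all_predC.
  by apply: sub_all am => x /=; rewrite -ltnNge => xm; apply: leq_ltn_trans nm.
by rewrite take0 drop0 /= (ltnW nm).
Qed.

(** Inserting as far south as possible keeps the row lengths sorted, and a
sorted sequence is determined by its multiset of values. *)
Lemma shape_insert_row_sorted r T l :
  sorted geq (shape T) -> sorted geq l -> perm_eq l (size r :: shape T) ->
  shape (insert_row r T) = l.
Proof.
move=> sT sl pl; apply: (@sorted_eq _ geq) => //.
- by move=> a b c /= ba /leq_trans; apply.
- by move=> a b /=; rewrite andbC => /anti_leq.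
- by rewrite shape_insert_row; apply: sorted_insert.
rewrite perm_sym; apply: perm_trans pl _.
by rewrite shape_insert_row perm_sym /= perm_catC /= perm_cons perm_catC cat_take_drop.
Qed.

Lemma count_ltn_iota m n : m <= n -> count (fun j => j < m) (iota 0 n) = m.
Proof.
move=> mn; rewrite -(subnKC mn) iotaD count_cat add0n.
rewrite (eq_in_count (_ : {in _, _ =1 predT})) ?count_predT ?size_iota; last first.
  by move=> j; rewrite mem_iota => /andP[].
rewrite (eq_in_count (_ : {in _, _ =1 pred0})) ?count_pred0 ?addn0 // => j.
by rewrite mem_iota /= => /andP[mj _]; apply/negbTE; rewrite -leqNgt.
Qed.

Lemma col_lenE T j : col_len T j = count (fun n => j < n) (shape T).
Proof. by rewrite /col_len /column size_map size_filter count_map. Qed.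

(** This is the conjugation of partitions: box [(i, j)] lies in the diagram both
when row [i] is long enough and when column [j] is. *)
Lemma ltn_col_len T i j : sorted geq (shape T) -> (i < col_len T j) = (j < row_len T i).
Proof.
move=> sT; rewrite col_lenE row_lenE; elim: (shape T) sT i => [|n s IH] ns i.
  by rewrite nth_nil.
have ga : transitive geq by move=> a b c /= ba /leq_trans; apply.
have /= := order_path_min ga ns; have := IH (path_sorted ns).
case: (ltnP j n) => jn h am /=; first by case: i => [|i] /=; rewrite ?jn ?add1n ?ltnS.
have s0 : count (fun n => j < n) s = 0.
  apply/eqP; rewrite -leqn0 leqNgt -has_count -all_predC.
  by apply: sub_all am => x /=; rewrite -leqNgt => xn; apply: leq_trans jn.
rewrite s0 ltn0; case: i => [|i] /=; first by rewrite ltnNge jn.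
by rewrite -h s0.
Qed.

Lemma size_unit_col h : 0 < h -> size (unit_col h) = h.
Proof. by rewrite size_rcons size_nseq => /prednK. Qed.

Lemma nth_unit_col h i : 0 < h -> nth false (unit_col h) i = (i == h.-1).
Proof. by move=> h0; rewrite nth_rcons size_nseq nth_nseq; case: ltngtP. Qed.

(** The columns of length at least [h] are those that reach row [h.-1], so the
new column is placed right after the last box of that row. *)
Lemma insert_unit_colE h T : sorted geq (shape T) -> 0 < h <= size T ->
  let k := row_len T h.-1 in
  insert_col (unit_col h) T =
  mkseq (fun i => let r := nth [::] T i in
    if i < h then take k r ++ (i == h.-1) :: drop k r else r) (size T).
Proof.
move=> sT /andP[h_gt0 hT] k; rewrite /insert_col.
have -> : count (fun j => size (unit_col h) <= col_len T j) (iota 0 (ncols T)) = k.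
  rewrite -(count_ltn_iota (_ : k <= ncols T)); last exact: row_len_mono.
  apply: eq_count => j; rewrite size_unit_col // -ltn_col_len //.
  by rewrite prednK.
by apply: eq_mkseq => i /=; rewrite size_unit_col // nth_unit_col.
Qed.

Section InsertUnitCol.
Variables (h : nat) (T : filling).
Hypotheses (sT : sorted geq (shape T)) (hT : 0 < h <= size T).
Let k := row_len T h.-1.
Let U := insert_col (unit_col h) T.

Let k_le i : i < h -> k <= row_len T i.
Proof. by move=> ih; apply: row_len_mono => //; lia. Qed.

Let k_ge i : h <= i -> row_len T i <= k.
Proof. by move=> ih; apply: row_len_mono => //; lia. Qed.

Lemma size_insert_unit_col : size U = size T.
Proof. by rewrite size_mkseq. Qed.

Let nthU i : nth [::] U i = if i < h then take k (nth [::] T i) ++ (i == h.-1) :: drop k (nth [::] T i)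
  else nth [::] T i.
Proof.
rewrite /U insert_unit_colE //; case: (ltnP i (size T)) => iT; first by rewrite nth_mkseq.
have /andP[_ hi] := hT.
by rewrite !(nth_default [::]) ?size_mkseq // ltnNge (leq_trans hi iT).
Qed.

Lemma row_len_insert_unit_col i : row_len U i = row_len T i + (i < h).
Proof.
rewrite /row_len nthU; case: (ltnP i h) => ih; last by rewrite addn0.
rewrite size_cat /= size_take size_drop; have := k_le ih.
by rewrite /row_len; case: ltnP => ?; lia.
Qed.

(** Below the new column the rows have length at most [k], so that renaming the
columns changes nothing there, even beyond the end of a row. *)
Let entry_off i j : entry U i (bump k j) = entry T i j.
Proof.
rewrite /entry nthU; case: ltnP => ih; first by rewrite nth_insert //; exact: k_le.
rewrite -!/(entry T _ _) /bump; case: leqP => kj //.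
by apply/idP/idP => /entry_lt; have := k_ge ih; lia.
Qed.

Let entry_new i : entry U i k = (i == h.-1).
Proof.
rewrite /entry nthU; case: ltnP => ih; first by rewrite nth_insert_eq //; exact: k_le.
have -> : (i == h.-1) = false by move: hT; lia.
by apply/negP => /entry_lt; have := k_ge ih; lia.
Qed.

(** The zeros of the new column have only zeros above them, and its 1 is the
last box both of its row and of its column, so it is no witness for any other
box. *)
Lemma pt_rule_insert_unit_col : pt_rule T -> pt_rule U.
Proof.
move=> [cT rT]; split=> [j|i j].
  rewrite /ncols row_len_insert_unit_col; case: (bumpP k j) => [_|{}j jT].
    by exists h.-1; rewrite entry_new eqxx.
  suff /cT[i e] : j < ncols T by exists i; rewrite entry_off.
  by move: jT; have := k_le (_ : 0 < h); rewrite /bump /ncols; lia.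
rewrite row_len_insert_unit_col; case: (bumpP k j) => [ji|{}j ji].
  case/one_aboveP => i' i'i; rewrite entry_new => /eqP e.
  by have := @k_ge i; lia.
have {ji} : j < row_len T i.
  move: ji; rewrite /bump; case: (ltnP i h) => ih; last by have := k_ge ih; lia.
  by have := k_le ih; lia.
rewrite entry_off => ji.
case/one_aboveP => i' i'i; rewrite entry_off => e1.
case/one_leftP => j'; case: (bumpP k j') => [|{}j'].
  rewrite entry_new => kj /eqP ie; move: ji kj; rewrite ie -/k /bump; lia.
rewrite ltn_bump entry_off => j'j e2.
by apply: rT => //; [apply/one_aboveP; exists i' | apply/one_leftP; exists j'].
Qed.

End InsertUnitCol.

Lemma row_len_delete_last_box k T i :
  row_len (delete_last_box k T) i = row_len T i - (i == k).
Proof.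
rewrite /row_len /delete_last_box nth_set_nth /=; case: eqP => [->|_]; last by rewrite subn0.
by rewrite size_take /row_len; case: ltnP => ?; lia.
Qed.

Lemma entry_delete_last_box k T i j :
  entry (delete_last_box k T) i j =
  entry T i j && ~~ ((i == k) && (j == (row_len T k).-1)).
Proof.
rewrite /entry /delete_last_box nth_set_nth /=; case: eqP => [->|_]; last by rewrite andbT.
rewrite /=; case: (ltngtP j (row_len T k).-1) => jk.
- by rewrite nth_take // andbT.
- by rewrite !(nth_default false) ?(size_takel (leq_pred _)) //; move: jk; rewrite /row_len; lia.
- by rewrite (nth_default false) ?andbF // (size_takel (leq_pred _)) jk.
Qed.

(** The column of a superfluous 1 keeps another 1. *)
Lemma pt_rule_delete_last_box k T : superfluous T k (row_len T k).-1 ->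
  pt_rule T -> pt_rule (delete_last_box k T).
Proof.
case/andP => _ /one_aboveP[i0 i0k e0] [cT rT]; split=> [j|i j].
  rewrite /ncols row_len_delete_last_box => jT.
  have [i e] : exists i, entry T i j by apply: cT; rewrite /ncols; lia.
  case E : ((i == k) && (j == (row_len T k).-1)); last first.
    by exists i; rewrite entry_delete_last_box e E.
  case/andP: E => _ /eqP ->; exists i0.
  by rewrite entry_delete_last_box e0 (ltn_eqF i0k).
rewrite row_len_delete_last_box entry_delete_last_box => ji.
case/one_aboveP => i' i'i; rewrite entry_delete_last_box => /andP[e1 _].
case/one_leftP => j' j'j; rewrite entry_delete_last_box => /andP[e2 _].
apply/andP; split.
  by apply: rT => //; [lia|apply/one_aboveP; exists i' | apply/one_leftP; exists j'].
by apply/negP => /andP[/eqP ik /eqP jk]; move: ji; rewrite ik eqxx jk; lia.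
Qed.

Lemma row_len_append_one k T i :
  row_len (append_one k T) i = row_len T i + (i == k).
Proof.
rewrite /row_len /append_one nth_set_nth /=; case: eqP => [->|_]; last by rewrite addn0.
by rewrite size_rcons addn1.
Qed.

Lemma entry_append_one k T i j :
  entry (append_one k T) i j =
  entry T i j || ((i == k) && (j == row_len T k)).
Proof.
rewrite /entry /append_one nth_set_nth /=; case: eqP => [->|_]; last by rewrite orbF.
rewrite nth_rcons /row_len; case: ltngtP => jk; rewrite ?orbF //.
by rewrite nth_default // ltnW.
by rewrite orbT.
Qed.

(** The new 1 is the last box of its row and of its column, so it is no
witness against any zero. *)
Lemma pt_rule_append_one k T : sorted geq (shape T) -> 0 < k ->
  pt_rule T -> pt_rule (append_one k T).
Proof.
move=> sT k_gt0 [cT rT]; split=> [j|i j].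
  rewrite /ncols row_len_append_one eq_sym (gtn_eqF k_gt0) addn0 => /cT[i e].
  by exists i; rewrite entry_append_one e.
rewrite row_len_append_one entry_append_one => ji.
case/one_aboveP => i' i'i; rewrite entry_append_one => e1.
case/one_leftP => j' j'j; rewrite entry_append_one => e2.
case E: ((i == k) && (j == row_len T k)); rewrite ?orbT ?orbF //.
have {}ji : j < row_len T i.
  by case: eqP ji E => [->|_] /=; [case: eqP => //; lia | lia].
apply: rT => //.
  case/orP: e1 => [e1|/andP[/eqP ? /eqP ?]]; first by apply/one_aboveP; exists i'.
  by subst i' j; have := row_len_mono sT (ltnW i'i); lia.
case/orP: e2 => [e2|/andP[/eqP ? /eqP ?]]; first by apply/one_leftP; exists j'.
by subst i j'; lia.
Qed.
(** * Transitions of the PT chain on fillings *)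

Definition incr (j : nat) (l : seq nat) : seq nat :=
  set_nth 0 l j (nth 0 l j).+1.

Lemma nth_decr j l i : nth 0 (decr j l) i = nth 0 l i - (i == j).
Proof. by rewrite nth_set_nth /=; case: eqP => [->|_]; rewrite ?subn0 ?subn1. Qed.

Lemma nth_incr j l i : nth 0 (incr j l) i = nth 0 l i + (i == j).
Proof. by rewrite nth_set_nth /=; case: eqP => [->|_]; rewrite ?addn0 ?addn1. Qed.

Lemma size_decr j l : j < size l -> size (decr j l) = size l.
Proof. by move=> jl; rewrite size_set_nth; apply/maxn_idPr. Qed.

Lemma size_incr j l : j < size l -> size (incr j l) = size l.
Proof. by move=> jl; rewrite size_set_nth; apply/maxn_idPr. Qed.

Lemma decr_inj j j' l : 0 < nth 0 l j -> decr j l = decr j' l -> j = j'.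
Proof. by move=> lj /(congr1 (nth 0 ^~ j)); rewrite !nth_decr eqxx; lia. Qed.

Lemma decrK j l : j < size l -> 0 < nth 0 l j -> incr j (decr j l) = l.
Proof.
move=> jl lj; apply: (@eq_from_nth _ 0); rewrite size_incr size_decr // => i _.
by rewrite nth_incr nth_decr; case: eqP => [->|_]; lia.
Qed.

Lemma incrK j l : j < size l -> decr j (incr j l) = l.
Proof.
move=> jl; apply: (@eq_from_nth _ 0); rewrite size_decr size_incr // => i _.
by rewrite nth_decr nth_incr; lia.
Qed.

Lemma sorted_parts w : sorted geq (parts w).
Proof.
elim: w => [|[] w IH] //=; have := head_parts w.
by case: (parts w) IH => //= x l ->; rewrite andbT.
Qed.

(** A corner box is the bottom box of its column, so a corner 1 is the only 1
in the column when there is none above it. *)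
Lemma corner_column T j : sorted geq (shape T) -> j < size T -> corner j (shape T) ->
  forall c, c = (row_len T j).-1 ->
  entry T j c -> necessary T j c = ~~ one_above T j c.
Proof.
rewrite /corner -!row_lenE => sT jT cj c cE e; rewrite /necessary e /=.
have -> : count id (column T c) = count (fun r => nth false r c) T.
  rewrite /column count_map count_filter; apply: eq_count => r /=.
  by case: (ltnP c (size r)) => h; rewrite ?andbT // nth_default.
have -> : one_above T j c = has (fun r => nth false r c) (take j T).
  apply/one_aboveP/(has_nthP [::]) => -[i]; rewrite ?size_takel ?(ltnW jT) // => ij.
    by exists i; rewrite ?size_takel ?(ltnW jT) // nth_take.
  by rewrite nth_take //; exists i.
rewrite -{1}(cat_take_drop j T) (drop_nth [::] jT) count_cat /= -/(entry T j c) e.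
rewrite has_count -leqNgt leqn0.
suff -> : count (fun r => nth false r c) (drop j.+1 T) = 0 by lia.
apply/eqP; rewrite -leqn0 leqNgt -has_count; apply/(has_nthP [::]) => -[i _].
rewrite nth_drop => /entry_lt.
by have := row_len_mono sT (leq_addr i j.+1); rewrite cE; lia.
Qed.

(** The column of a corner 0 contains a 1, necessarily above it; by the second
condition no 1 is then allowed to its left. *)
Lemma corner_zero_row T j : sorted geq (shape T) -> pt_rule T -> corner j (shape T) ->
  ~~ entry T j (row_len T j).-1 -> forall j', ~~ entry T j j'.
Proof.
rewrite /corner -!row_lenE => sT [cT rT] cj e j'; apply/negP => e'.
have jc : (row_len T j).-1 < row_len T j by lia.
have [i ei] : exists i, entry T i (row_len T j).-1.
  by apply: cT; have := row_len_mono sT (leq0n j); rewrite /ncols; lia.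
have ij : i < j.
  have := entry_lt ei; case: (ltngtP i j) => // [ij|ij]; last by move: e; rewrite -{1}ij ei.
  by have := row_len_mono sT ij; lia.
have j'c : j' < (row_len T j).-1.
  have := entry_lt e'; case: (ltngtP j' (row_len T j).-1) => // [|jE]; first by lia.
  by rewrite -jE e' in e.
move/negP: e; apply; apply: rT => //; first by apply/one_aboveP; exists i.
by apply/one_leftP; exists j'.
Qed.

(** The three clauses of [pt_hop_right] are mutually exclusive and exhaustive at
a corner, so they single out one filling.  In the first the row of length
[c.+1] is traded for one of length [c]; in the third the rows above row [j]
lose a box with the deleted column and regain one with the inserted column. *)
Lemma hop_right_result (S : filling) j :
  sorted geq (shape S) -> pt_rule S -> 0 < j < size S -> corner j (shape S) ->
  exists R : filling, [/\ sorted geq (shape R), pt_rule R, shape R = decr j (shape S)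
    & forall T, pt_hop_right j S T = (T == R)].
Proof.
move=> sS fS /andP[j_gt0 jS] cj; have := cj; rewrite /corner -!row_lenE => lj.
rewrite /pt_hop_right lj /=; set c := (row_len S j).-1.
have sd : sorted geq (decr j (shape S)).
  apply/(sortedP 0) => i _ /=; rewrite !nth_decr -!row_lenE.
  have := row_len_mono sS (leqnSn i); case: (eqVneq i j) => [->|]; last by lia.
  by rewrite (gtn_eqF (ltnSn j)); lia.
have jl : j < size (shape S) by rewrite size_map.
suff [R [fR dR TR]] : exists R : filling, [/\ pt_rule R, shape R = decr j (shape S) &
    forall T, [|| ~~ entry S j c && (T == insert_row (nseq c false) (delete_row j S)),
      superfluous S j c && (T == delete_last_box j S)
    | necessary S j c && (T == insert_col (unit_col j) (delete_col c S))] = (T == R)].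
  by exists R; split=> //; rewrite dR.
have := corner_column sS jS cj (erefl c); rewrite /superfluous.
have := corner_zero_row sS fS cj; rewrite -/c.
case e : (entry S j c) => /=; [move=> _ /(_ isT) -> | move=> /(_ isT) e0 _]; last first.
  exists (insert_row (nseq c false) (delete_row j S)).
  have cS : c <= ncols (delete_row j S).
    rewrite /ncols row_len_delete_row bump0 //.
    by have := row_len_mono sS (leq0n j); rewrite /c; lia.
  split=> [| |T]; last by rewrite /necessary e /= orbF.
    apply: pt_rule_insert_zero_row => //; last exact: pt_rule_delete_row.
    by rewrite size_cat size_takel ?size_drop //; lia.
  apply: shape_insert_row_sorted => //; first exact: sorted_delete_row.
  rewrite size_nseq /delete_row /shape map_cat map_take map_drop -/(shape S).
  rewrite /decr set_nthE jl -row_lenE -/c.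
  by rewrite perm_catC /= perm_cons perm_catC.
case: (boolP (one_above S j c)) => a /=.
  exists (delete_last_box j S); split=> [| |T]; last by rewrite orbF.
    by apply: pt_rule_delete_last_box => //; rewrite /superfluous e.
  apply: shape_eq => [|i]; first by rewrite size_decr // !size_map size_set_nth; apply/maxn_idPr.
  by rewrite row_len_delete_last_box nth_decr -row_lenE.
exists (insert_col (unit_col j) (delete_col c S)).
have sD := sorted_delete_col c sS.
have jD : 0 < j <= size (delete_col c S) by rewrite size_delete_col j_gt0 ltnW.
split=> [| |T] //; first by apply: pt_rule_insert_unit_col => //; apply: pt_rule_delete_col.
apply: shape_eq => [|i]; first by rewrite size_insert_unit_col size_delete_col size_decr // size_map.
rewrite row_len_insert_unit_col // row_len_delete_col nth_decr -row_lenE.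
case: (ltngtP i j) => [ij|ij|->].
- by have := row_len_mono sS (ltnW ij); rewrite /c; lia.
- by have := row_len_mono sS ij; rewrite /c; lia.
- by rewrite /c; lia.
Qed.

Lemma hop_left_result (S : filling) j :
  sorted geq (shape S) -> pt_rule S -> j.+1 < size S -> corner j (shape S) ->
  exists R : filling, [/\ sorted geq (shape R), pt_rule R, shape R = incr j.+1 (shape S)
    & forall T, pt_hop_left j S T = (T == R)].
Proof.
move=> sS fS jS; rewrite /corner -!row_lenE => lj.
exists (append_one j.+1 S); split=> [| | |T]; last by rewrite /pt_hop_left lj.
- apply: sorted_shape => i; rewrite !row_len_append_one.
  have := row_len_mono sS (leqnSn i); case: (eqVneq i j) => [->|]; last by lia.
  by rewrite eqxx; lia.
- exact: pt_rule_append_one.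
apply: shape_eq => [|i]; last by rewrite row_len_append_one nth_incr -row_lenE.
by rewrite size_incr !size_map // size_set_nth; apply/maxn_idPr.
Qed.

(** The last column has length 1 exactly when the first row is strictly the
longest.  Deleting this column leaves a first row of length [n], and the new
zero row goes below it and all other rows of length [n]. *)
Lemma enter_result (S : filling) n l :
  sorted geq (shape S) -> pt_rule S -> shape S = n.+1 :: l -> nth 0 l 0 <= n ->
  exists R : filling, [/\ sorted geq (shape R), pt_rule R, shape R = [:: n, n & l]
    & forall T, pt_enter S T = (T == R)].
Proof.
move=> sS fS Sl ln.
have S0 : row_len S 0 = n.+1 by rewrite row_lenE Sl.
have S1 : row_len S 1 = nth 0 l 0 by rewrite row_lenE Sl.
have cS : col_len S n == 1.
  by rewrite eqn_leq ltn_col_len // S0 ltnSn andbT leqNgt ltn_col_len // S1 -leqNgt.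
rewrite /pt_enter /ncols S0 /= cS /=.
exists (insert_row (nseq n false) (delete_col n S)).
have sD := sorted_delete_col n sS.
have SD : shape (delete_col n S) = n :: l.
  apply: shape_eq => [|i]; first by rewrite size_delete_col -(size_map size) -/(shape S) Sl.
  rewrite row_len_delete_col row_lenE Sl; case: i => [|i] /=; first by lia.
  by have := row_len_mono sS (ltn0Sn i); rewrite S1 row_lenE Sl /=; lia.
have sR : sorted geq [:: n, n & l].
  by rewrite /= leqnn /=; move: sD; rewrite SD.
have eR : shape (insert_row (nseq n false) (delete_col n S)) = [:: n, n & l].
  by apply: shape_insert_row_sorted => //; rewrite SD size_nseq.
split=> //; first by rewrite eR.
apply: pt_rule_insert_zero_row; last exact: pt_rule_delete_col.
  by rewrite /ncols row_lenE SD.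
by rewrite -(size_map size) -/(shape _) SD.
Qed.

Lemma pt_enter_shape (S T : filling) : sorted geq (shape S) -> pt_enter S T ->
  exists n l, shape S = n.+1 :: l /\ nth 0 l 0 <= n.
Proof.
move=> sS /and3P[]; rewrite /ncols; set c := row_len S 0 => c_gt0 /eqP cS _.
exists c.-1, (behead (shape S)).
have eS : shape S = c :: behead (shape S).
  by move: c_gt0; rewrite /c row_lenE; case: (shape S).
split; first by rewrite prednK.
have /negbT : 1 < col_len S c.-1 = false by rewrite cS.
by rewrite ltn_col_len // row_lenE eS /= -leqNgt.
Qed.

(** The deleted row is empty, and the inserted column is as tall as the
remaining diagram, which adds a box to every remaining row. *)
Lemma exit_result (S : filling) l :
  sorted geq (shape S) -> pt_rule S -> shape S = rcons l 0 -> 0 < size l ->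
  exists R : filling, [/\ sorted geq (shape R), pt_rule R, shape R = map succn l
    & forall T, pt_exit S T = (T == R)].
Proof.
move=> sS fS Sl l_gt0.
have sizeS : size S = (size l).+1 by rewrite -(size_map size) -/(shape S) Sl size_rcons.
have Sr i : row_len S i = nth 0 l i.
  rewrite row_lenE Sl nth_rcons; case: ltngtP => //; last by move=> ->; rewrite nth_default.
  by move=> li; rewrite nth_default // ltnW.
rewrite /pt_exit sizeS /= ltnS l_gt0 Sr nth_default //=.
exists (insert_col (unit_col (size l)) (delete_row (size l) S)).
have sD := sorted_delete_row (size l) sS.
have sizeD : size (delete_row (size l) S) = size l.
  by rewrite size_cat size_takel ?size_drop sizeS; lia.
have lD : 0 < size l <= size (delete_row (size l) S) by rewrite sizeD l_gt0 /=.
split=> [| | |T] //.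
- apply: sorted_shape => i; rewrite !row_len_insert_unit_col //.
  by have := row_len_mono sD (leqnSn i); lia.
- apply: pt_rule_insert_unit_col => //; apply: pt_rule_delete_row => // j.
  by apply/negP => /entry_lt; rewrite Sr nth_default.
apply: shape_eq => [|i]; first by rewrite size_insert_unit_col sizeD size_map.
rewrite row_len_insert_unit_col // row_len_delete_row Sr.
case: (ltnP i (size l)) => il; first by rewrite (nth_map 0) // /bump leqNgt il addn1.
by rewrite addn0 !nth_default ?size_map // /bump il; lia.
Qed.

Lemma pt_exit_shape (S T : filling) : pt_exit S T ->
  exists2 l, 0 < size l & shape S = rcons l 0.
Proof.
move=> /and3P[]; rewrite row_lenE -(size_map size) -/(shape S) nth_last.
case: (lastP (shape S)) => // l x; rewrite size_rcons last_rcons ltnS => l0 /eqP -> _.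
by exists l.
Qed.

(** * The correspondence of the moves *)

Section Steps.
Variable N : nat.
Implicit Types (S T : perm_tableau N) (Y : N.-tuple bool).

(** For any shape, ones in the first row and zeros elsewhere give a permutation
tableau: every column has its 1 on top, and no 0 has a 1 to its left. *)
Lemma pr_surj Y : exists T : perm_tableau N, pr T = Y.
Proof.
set n := count negb Y; set l := parts Y.
pose T : filling := nseq n true :: [seq nseq m false | m <- l].
have sT : shape T = parts (true :: Y).
  rewrite /shape /= size_nseq -map_comp; congr (_ :: _).
  by rewrite -[RHS]map_id; apply: eq_map => m /=; rewrite size_nseq.
have e0 i j : entry T i.+1 j = false.
  rewrite /entry /=; case: (ltnP i (size l)) => il.
    by rewrite (nth_map 0) // nth_nseq if_same.
  by rewrite (nth_default [::]) ?size_map // nth_nil.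
have [||//|T' _ TY] := @tableau_of_shape N Y T; last by exists T'.
- by rewrite sT; apply: sorted_parts.
- split=> [j jn|[|i] j _].
  + by exists 0; move: jn; rewrite /ncols /row_len /entry /= size_nseq nth_nseq => ->.
  + by case/one_aboveP.
  + by move=> _ /one_leftP[j' _]; rewrite e0.
Qed.

Let size_pr S T : size (pr S) = size (pr T).
Proof. by rewrite (size_tuple (pr S)) (size_tuple (pr T)). Qed.

Let size_word S Y : size (pr S) = size Y.
Proof. by rewrite (size_tuple (pr S)) (size_tuple Y). Qed.

Lemma pt_enter_pr S T : pt_enter S T -> enter (pr S) (pr T).
Proof.
have [_ sS fS _] := tabP S => h; have [n [l [Sl ln]]] := pt_enter_shape sS h.
have [R [_ _ Rl RE]] := enter_result sS fS Sl ln.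
apply/(enterP (size_pr S T)); exists n, l; rewrite -!shape_pr; split=> //.
by move: h; rewrite RE => /eqP ->.
Qed.

Lemma pt_exit_pr S T : pt_exit S T -> exit (pr S) (pr T).
Proof.
have [_ sS fS _] := tabP S => h; have [l l0 Sl] := pt_exit_shape h.
have [R [_ _ Rl RE]] := exit_result sS fS Sl l0.
apply/(exitP (size_pr S T)); exists l; rewrite -?shape_pr //; split=> //.
by move: h; rewrite RE => /eqP ->.
Qed.

Lemma pt_hop_right_shape S T j : 0 < j < size S -> pt_hop_right j S T ->
  corner j (shape S) /\ shape T = decr j (shape S).
Proof.
have [_ sS fS _] := tabP S => jS h.
have cj : corner j (shape S) by rewrite /corner -!row_lenE; case/andP: h.
split=> //; have [R [_ _ <- RE]] := hop_right_result sS fS jS cj.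
by move: h; rewrite RE => /eqP ->.
Qed.

Lemma pt_hop_right_pr S T j : 0 < j < size S -> pt_hop_right j S T -> hop (pr S) (pr T).
Proof.
move=> jS /(pt_hop_right_shape jS)[cj TE]; apply/(hopP (size_pr S T)).
by exists j; rewrite -?shape_pr // size_map.
Qed.

Lemma pt_hop_left_shape S T j : j.+1 < size S -> pt_hop_left j S T ->
  corner j (shape S) /\ shape T = incr j.+1 (shape S).
Proof.
have [_ sS fS _] := tabP S => jS h.
have cj : corner j (shape S) by rewrite /corner -!row_lenE; case/andP: h.
split=> //; have [R [_ _ <- RE]] := hop_left_result sS fS jS cj.
by move: h; rewrite RE => /eqP ->.
Qed.

Lemma pt_hop_left_pr S T j : j.+1 < size S -> pt_hop_left j S T -> hop (pr T) (pr S).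
Proof.
move=> jS /(pt_hop_left_shape jS)[cj TE]; apply/(hopP (size_pr T S)).
have jl : j.+1 < size (shape S) by rewrite size_map.
exists j.+1; rewrite -!shape_pr TE ?incrK ?size_incr //.
split=> //; rewrite /corner !nth_incr -!row_lenE eqxx.
have [_ sS _ _] := tabP S.
by have := row_len_mono sS (leqnSn j.+1); lia.
Qed.

Let target Y (R : filling) (P : filling -> bool) :
  sorted geq (shape R) -> pt_rule R -> shape R = parts (true :: Y) ->
  (forall T : filling, P T = (T == R)) ->
  exists2 T0 : perm_tableau N, pr T0 = Y & forall T, P T = (T == T0).
Proof.
move=> sR fR eR PR; have [T0 T0R T0Y] := tableau_of_shape sR fR eR.
exists T0 => // T; rewrite PR -T0R.
by apply/eqP/eqP => [/rows_inj|->].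
Qed.

Lemma enter_lift S Y : enter (pr S) Y ->
  exists2 T0 : perm_tableau N, pr T0 = Y & forall T, pt_enter S T = (T == T0).
Proof.
case/(enterP (size_word S Y)) => n [l []]; rewrite -shape_pr => Sl ln Yl.
have [_ sS fS _] := tabP S; have [R [sR fR Rl RE]] := enter_result sS fS Sl ln.
by apply: (target sR fR); rewrite ?Rl.
Qed.

Lemma exit_lift S Y : exit (pr S) Y ->
  exists2 T0 : perm_tableau N, pr T0 = Y & forall T, pt_exit S T = (T == T0).
Proof.
case/(exitP (size_word S Y)) => l l0 []; rewrite -shape_pr => Sl Yl.
have [_ sS fS _] := tabP S; have [R [sR fR Rl RE]] := exit_result sS fS Sl l0.
by apply: (target sR fR); rewrite ?Rl.
Qed.

(** The row whose corner is removed is determined by the two shapes, so only one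
index contributes to the transitions from [S] to a tableau over [Y]. *)
Lemma hop_right_lift S Y : hop (pr S) Y ->
  exists2 T0 : perm_tableau N, pr T0 = Y &
  exists2 j, 0 < j < size S & forall i T, 0 < i < size S -> pr T = Y ->
    pt_hop_right i S T = (i == j) && (T == T0).
Proof.
case/(hopP (size_word S Y)) => j; rewrite -shape_pr size_map => jS [cj Yj].
have [_ sS fS _] := tabP S; have [R [sR fR Rl RE]] := hop_right_result sS fS jS cj.
have eR : shape R = parts (true :: Y) by rewrite Rl.
have [T0 T0Y T0E] := target sR fR eR RE.
exists T0 => //; exists j => // i T iS /prE TY.
case: (eqVneq i j) => [->|ij]; first exact: T0E.
apply/negP => /(pt_hop_right_shape iS)[ci Ti].
case/eqP: ij; apply: (@decr_inj _ _ (shape S)); last by rewrite -Ti TY.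
by move: ci; rewrite /corner; lia.
Qed.

(** On shapes a hop to the left is a hop to the right read backwards, the roles
of [Y] and [pr S] being exchanged; row [j.+1] then has a corner in the shape of
[Y], so that row [j] has one in the shape of [S]. *)
Lemma hop_left_lift S Y : hop Y (pr S) ->
  exists2 T0 : perm_tableau N, pr T0 = Y &
  exists2 j, j.+1 < size S & forall i T, i.+1 < size S -> pr T = Y ->
    pt_hop_left i S T = (i == j) && (T == T0).
Proof.
case/(hopP (esym (size_word S Y))) => j.
case: j => [//|j] /andP[_ jY]; rewrite -shape_pr => -[cj Sj].
have Yj : parts (true :: Y) = incr j.+1 (shape S).
  by rewrite Sj decrK //; move: cj; rewrite /corner; lia.
have jS : j.+1 < size S.
  by rewrite -(size_map size) -/(shape S) Sj size_decr.
have [_ sS fS _] := tabP S.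
have cS : corner j (shape S).
  rewrite /corner Sj !nth_decr eqxx.
  have : nth 0 (parts (true :: Y)) j.+1 <= nth 0 (parts (true :: Y)) j.
    exact: (elimT (sortedP 0) (sorted_parts (true :: Y)) _ jY).
  by move: cj; rewrite /corner; lia.
have [R [sR fR Rl RE]] := hop_left_result sS fS jS cS.
have eR : shape R = parts (true :: Y) by rewrite Rl.
have [T0 T0Y T0E] := target sR fR eR RE.
exists T0 => //; exists j => // i T iS /prE TY.
case: (eqVneq i j) => [->|ij]; first exact: T0E.
apply/negP => /(pt_hop_left_shape iS)[ci Ti].
case/eqP: ij; have : incr i.+1 (shape S) = incr j.+1 (shape S) by rewrite -Ti TY.
by move=> /(congr1 (nth 0 ^~ i.+1)); rewrite !nth_incr eqxx; lia.
Qed.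

End Steps.

(** * Mutual exclusion of the moves *)

(** The number of particles tells hops, entries and exits apart; the number of
boxes of the partition tells the two directions of a hop apart. *)
Lemma hop_count X Y : hop X Y -> count id X = count id Y.
Proof. by case=> A [B [-> ->]]; rewrite !count_cat. Qed.

Lemma hop_sum X Y : hop X Y -> sumn (parts Y) < sumn (parts X).
Proof.
case=> A [B [-> ->]]; have [l _ E] := parts_split A [:: true, false & B].
by rewrite !E // !sumn_cat /=; lia.
Qed.

Lemma enter_count X Y : enter X Y -> count id Y = (count id X).+1.
Proof. by case=> B [-> ->]. Qed.

Lemma exit_count X Y : exit X Y -> count id X = (count id Y).+1.
Proof. by case=> B [-> ->]; rewrite -(cats1 B true) -(cats1 B false) !count_cat /=; lia. Qed.

Local Open Scope ring_scope.

(** * Lumping the PT chain *)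

(** By the mutual exclusion at most one kind of move leads from [pr S] to [Y],
so at most one summand of [pt_step] survives on the fibre over [Y].  When no
move leads there both rates vanish, and any point of the fibre can serve as
[T0]. *)
Lemma step_lift (R : realType) (N : nat) (alpha beta q : R)
    (S : perm_tableau N) (Y : N.-tuple bool) :
  exists2 T0 : perm_tableau N, pr T0 = Y &
    forall T, pr T = Y -> pt_step alpha beta q S T =
      if T == T0 then pasep_step alpha beta q (pr S) Y else 0.
Proof.
have noR : ~ hop (pr S) Y -> forall T, pr T = Y ->
    \sum_(1 <= j < size S) (1 / N.+1%:R : R) *+ pt_hop_right j S T = 0.
  move=> h T TY; rewrite big_nat big1 // => j jS.
  suff -> : pt_hop_right j S T = false by [].
  by apply/negP => /(pt_hop_right_pr jS); rewrite TY.
have noL : ~ hop Y (pr S) -> forall T, pr T = Y ->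
    \sum_(0 <= j < (size S).-1) (q / N.+1%:R : R) *+ pt_hop_left j S T = 0.
  move=> h T TY; rewrite big_nat big1 // => j jS.
  have {}jS : (j.+1 < size S)%N by lia.
  suff -> : pt_hop_left j S T = false by [].
  by apply/negP => /(pt_hop_left_pr jS); rewrite TY.
have noE : ~ enter (pr S) Y -> forall T, pr T = Y -> pt_enter S T = false.
  by move=> h T TY; apply/negP => /pt_enter_pr; rewrite TY.
have noX : ~ exit (pr S) Y -> forall T, pr T = Y -> pt_exit S T = false.
  by move=> h T TY; apply/negP => /pt_exit_pr; rewrite TY.
rewrite /pt_step /pasep_step.
case: asboolP => [hR|/noR nR].
  have nL : ~ hop Y (pr S) by move=> /hop_sum; have := hop_sum hR; lia.
  have nE : ~ enter (pr S) Y by move=> /enter_count; have := hop_count hR; lia.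
  have nX : ~ exit (pr S) Y by move=> /exit_count; have := hop_count hR; lia.
  have [T0 T0Y [j jS h]] := hop_right_lift hR; exists T0 => // T TY.
  rewrite noE // noX // noL // !mulr0n !addr0 add0r.
  rewrite (bigD1_seq j) ?mem_index_iota ?iota_uniq //= h // eqxx /= big_nat_cond big1.
    by rewrite addr0; case: eqP.
  by move=> i /andP[iS ij]; rewrite h // (negPf ij).
case: asboolP => [hL|/noL nL].
  have nE : ~ enter (pr S) Y by move=> /enter_count; have := hop_count hL; lia.
  have nX : ~ exit (pr S) Y by move=> /exit_count; have := hop_count hL; lia.
  have [T0 T0Y [j jS h]] := hop_left_lift hL; exists T0 => // T TY.
  rewrite noE // noX // nR // !mulr0n !add0r.
  have jr : j \in index_iota 0 (size S).-1 by rewrite mem_index_iota; lia.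
  rewrite (bigD1_seq j) ?iota_uniq //= h // eqxx /= big_nat_cond big1.
    by rewrite addr0; case: eqP.
  by move=> i /andP[iS ij]; rewrite h ?(negPf ij) //; lia.
case: asboolP => [hE|/noE nE].
  have nX : ~ exit (pr S) Y by move=> /exit_count; have := enter_count hE; lia.
  have [T0 T0Y h] := enter_lift hE; exists T0 => // T TY.
  by rewrite noX // nR // nL // h mulr0n !addr0; case: eqP.
case: asboolP => [hX|/noX nX].
  have [T0 T0Y h] := exit_lift hX; exists T0 => // T TY.
  by rewrite nE // nR // nL // h mulr0n addr0 !add0r; case: eqP.
have [T0 T0Y] := pr_surj Y; exists T0 => // T TY.
by rewrite nE // nX // nR // nL // !mulr0n !addr0 if_same.
Qed.

(** If the rates out of [x] into each fibre sit on a single point, with the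
value prescribed by [p], then the sum of the rates out of [x] is the sum of the
rates out of [F x], and the diagonals agree.  A fibre receives no rate from its
own points, since [p y y = 0]; hence a state reached with positive probability
within the fibre of [x] can only be [x] itself. *)
Lemma projects_of_lift (R : realType) (X Y : finType) (m : X -> X -> R)
    (p : Y -> Y -> R) (F : X -> Y) :
  (forall x x', 0 <= chain_of_step m x x') ->
  (forall y y', 0 <= chain_of_step p y y') ->
  (forall y, exists x, F x = y) ->
  (forall y, p y y = 0) ->
  (forall x y, exists2 x0, F x0 = y &
    forall x', F x' = y -> m x x' = if x' == x0 then p (F x) y else 0) ->
  projects_to (chain_of_step m) (chain_of_step p) F.
Proof.
move=> m_ge0 p_ge0 surjF p_diag lift.
have stoch (Z : finType) (s : Z -> Z -> R) z : \sum_z' chain_of_step s z z' = 1.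
  rewrite (bigD1 z) //= {1}/chain_of_step eqxx.
  rewrite [X in _ + X](eq_bigr (s z)) ?subrK // => z' z'z.
  by rewrite /chain_of_step eq_sym (negPf z'z).
have m_fiber x x' : F x' = F x -> m x x' = 0.
  by move=> e; have [x0 _ ->] := lift x (F x); rewrite ?p_diag ?if_same.
have diag x : chain_of_step m x x = chain_of_step p (F x) (F x).
  rewrite /chain_of_step !eqxx; congr (1 - _).
  have -> : \sum_(z | z != x) m x z = \sum_z m x z.
    by rewrite [RHS](bigD1 x) //= m_fiber // add0r.
  have -> : \sum_(y | y != F x) p (F x) y = \sum_y p (F x) y.
    by rewrite [RHS](bigD1 (F x)) //= p_diag add0r.
  rewrite (partition_big F predT) //=; apply: eq_bigr => y _.
  have [x0 x0y h] := lift x y.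
  rewrite (bigD1 x0) ?x0y //= h // eqxx big1 ?addr0 // => z /andP[/eqP zy zx0].
  by rewrite h // (negPf zx0).
have pos x x' : x != x' -> 0 < m x x' -> F x != F x' /\ m x x' = p (F x) (F x').
  move=> _ mp; split; first by apply/eqP => /esym/m_fiber e; rewrite e ltxx in mp.
  have [x0 _ h] := lift x (F x'); move: mp; rewrite h //.
  by case: ifP => // _; rewrite ltxx.
split=> //.
- move=> x x'; case: (eqVneq x x') => [<- _|xx']; first exact: diag.
  rewrite /chain_of_step (negPf xx') => /(pos _ _ xx')[nF ->].
  by rewrite (negPf nF).
move=> y y' yy' x Fx; subst y; case: (eqVneq (F x) y') yy' => [<- yy|ne].
  exists x; last exact: diag.
  split; first by rewrite diag.
  move=> x' [Fx' mp]; apply/eqP; apply: contraTT mp => xx'.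
  by rewrite /chain_of_step (negPf xx') m_fiber // ltxx.
rewrite /chain_of_step (negPf ne) => pp.
have [x0 x0y h] := lift x y'.
have nx z : F z = y' -> (x == z) = false by move=> zy; apply/eqP => e; rewrite e zy eqxx in ne.
exists x0; last by rewrite nx // h // eqxx.
split; first by rewrite nx // h // eqxx.
move=> z [zy]; rewrite nx // h //; by case: eqP => [-> //|_]; rewrite ltxx.
Qed.

Theorem corollary4p5 (R : realType) (N : nat) (alpha beta q : R)
    (N_ge1 : (1 <= N)%N)
    (alpha_gt0 : 0 < alpha) (beta_gt0 : 0 < beta) (q_ge0 : 0 <= q)
    (pasep_prob : forall X Y : N.-tuple bool,
       0 <= pasep alpha beta q X Y <= 1)
    (pt_prob : forall S T : perm_tableau N,
       0 <= pt_chain alpha beta q S T <= 1) :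
  projects_to (pt_chain alpha beta q) (pasep alpha beta q) (@pr N).
Proof.
apply: projects_of_lift => [S T|X Y|||].
- by case/andP: (pt_prob S T).
- by case/andP: (pasep_prob X Y).
- exact: pr_surj.
- move=> X; rewrite /pasep_step.
  case: asboolP => [/hop_sum|_]; first by rewrite ltnn.
  case: asboolP => [/enter_count|_]; first by lia.
  by case: asboolP => [/exit_count|_] //; lia.
- exact: step_lift.
Qed.
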